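(* Let $F$ be a graph and let $F'$ be a graph resulting from the deletion of a vertex from $F$. Let $c=c(n)$ be such that $\mathrm{ex}(n,K_{r-1},F')\le c\,n$ for every $n$. Then \[\mathrm{ex}_r(n,\text{Berge-}F)\le \max\left\{\frac{2c}{r}, 1 \right\} \mathrm{ex}(n,F).\]
   Context: All graphs and hypergraphs are finite and simple. The integer $r$ is the uniformity of the hypergraphs considered, and $K_{r-1}$ is the complete graph on $r-1$ vertices. A hypergraph $\mathcal{H}$ contains a Berge-$F$ (Berge copy of the graph $F$) if there are an injection $\varphi:V(F)\to V(\mathcal{H})$ and an injection $f:E(F)\to E(\mathcal{H})$ with $\{\varphi(u),\varphi(v)\}\subset f(uv)$ for every edge $uv\in E(F)$; otherwise it is Berge-$F$-free. $\mathrm{ex}_r(n,\text{Berge-}F)$ is the maximum number of hyperedges in an $n$-vertex $r$-uniform Berge-$F$-free hypergraph. A graph is $F$-free if it has no (not necessarily induced) subgraph isomorphic to $F$. $\mathrm{ex}(n,F)$ is the maximum number of edges, and $\mathrm{ex}(n,H,F)$ the maximum number of copies of the graph $H$, in an $n$-vertex $F$-free graph.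
   Formalization: The condition on c = c(n) is taken as ex(m,K_{r-1},F') ≤ c(n)·m for every m ≤ n (automatic if c is constant or nondecreasing in n); with the bound only at m = n for an arbitrary function c(n), the claim is false. *)

(* Defs.v *)
From HB Require Import structures.
From mathcomp Require Import all_boot all_order all_algebra.
Set Implicit Arguments.
Unset Strict Implicit.
Unset Printing Implicit Defensive.

Definition uniform (T : finType) (r : nat) (E : {set {set T}}) : bool :=
  [forall e in E, #|e| == r].

(* An r-uniform simple hypergraph on the vertex set T. *)
Record hypergraph (r : nat) (T : finType) := Hypergraph {
  edges :> {set {set T}};
  edges_uniform : uniform r edges }.

HB.instance Definition _ r T := [isSub for @edges r T].
HB.instance Definition _ r T := [Finite of hypergraph r T by <:].

(* Simple graphs are the 2-uniform hypergraphs: the edge uv is [set u; v]. *)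
Notation sgraph := (hypergraph 2).

Section Containment.
Variables (T U : finType) (F : sgraph T).

(* phi is injective on all of T: isolated vertices of F also need their own   *)
(* images, and phi @: e is the edge {phi u, phi v} for e = uv.                *)
Definition embeddings (G : sgraph U) : {set {ffun T -> U}} :=
  [set phi : {ffun T -> U} |
    injectiveb phi && [forall e in edges F, phi @: e \in edges G]].

Definition contains (G : sgraph U) : bool := embeddings G != set0.

(* Only the values of f on the edges of F are relevant.                       *)
Definition contains_berge (r : nat) (H : hypergraph r U) : bool :=
  [exists phi : {ffun T -> U}, exists f : {ffun {set T} -> {set U}},
    [&& injectiveb phi, dinjectiveb f (mem (edges F)) &
        [forall e in edges F, (f e \in edges H) && (phi @: e \subset f e)]]].

(* A copy of F in G is a subgraph of G isomorphic to F, recorded as the pair  *)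
(* (vertex set, edge set); the vertex set matters for graphs with isolated    *)
(* vertices such as K_1.                                                      *)
Definition copies (G : sgraph U) : {set {set U} * {set {set U}}} :=
  [set (phi @: [set: T], [set phi @: (e : {set T}) | e in edges F])
    | phi : {ffun T -> U} in embeddings G].

End Containment.

Fact complete_uniform (k : nat) : uniform 2 [set e : {set 'I_k} | #|e| == 2].
Proof. by apply/forall_inP => e; rewrite inE. Qed.

Definition complete (k : nat) : sgraph 'I_k := Hypergraph (complete_uniform k).

Fact del_vertex_uniform (T : finType) (F : sgraph T) (v : T) :
  uniform 2 [set e : {set {x : T | x != v}} | val @: e \in edges F].
Proof.
apply/forall_inP => e; rewrite inE => eF.
by have /forall_inP/(_ _ eF) := edges_uniform F; rewrite card_imset //; apply: val_inj.
Qed.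

Definition del_vertex (T : finType) (F : sgraph T) (v : T) :
  sgraph {x : T | x != v} := Hypergraph (del_vertex_uniform F v).

(* In the three extremal numbers the maximum of an empty family (possible     *)
(* only if the forbidden graph has no edges) is 0.                            *)

Definition ex (n : nat) (T : finType) (F : sgraph T) : nat :=
  \max_(G : sgraph 'I_n | ~~ contains F G) #|edges G|.

Definition ex_copies (n : nat) (S T : finType) (H : sgraph S) (F : sgraph T)
  : nat := \max_(G : sgraph 'I_n | ~~ contains F G) #|copies H G|.

Definition ex_berge (r n : nat) (T : finType) (F : sgraph T) : nat :=
  \max_(H : hypergraph r 'I_n | ~~ contains_berge F H) #|edges H|.

(* Main.v *)
(** The hyperedges of a Berge-F-free hypergraph H are matched to pairs of
    vertices they contain, by a matching with as many pairs as possible.  The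
    matched pairs form an F-free graph G.  Let A be the set of hyperedges
    reachable from unmatched ones by alternating paths, call the pairs inside
    members of A red, and the other edges of G blue.  Red pairs are all
    matched, so each member of A is an r-clique of the red graph, while the
    hyperedges outside A are matched to distinct blue edges.  In an F-free graph
    neighbourhoods are F'-free, so the red graph has at most
    (1/r) \sum_x c d(x) = (2c/r) |red| cliques of size r. *)

Require Import Defs.
From mathcomp Require Import all_boot all_order all_algebra.
Import Order.TTheory GRing.Theory Num.Theory.

(** * Maximum bipartite matchings and alternating paths *)

Section Matching.
Variables (X Y : finType) (e : X -> Y -> bool).

(** The matching consists of the pairs [(f y, y)] with [y] in [S]; values of [f] off [S] are
    irrelevant. *)
Definition matching (S : {set Y}) (f : {ffun Y -> X}) : bool :=
  dinjectiveb f (mem S) && [forall y in S, e (f y) y].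

Lemma matchingP (S : {set Y}) (f : {ffun Y -> X}) :
  reflect ({in S &, injective f} /\ {in S, forall y, e (f y) y}) (matching S f).
Proof.
apply: (iffP andP) => -[fS eS]; split.
- exact/dinjectiveP.
- exact/forall_inP.
- exact/dinjectiveP.
- exact/forall_inP.
Qed.

(** Two edges of an alternating path at once: any edge to a matched [y], then the matching edge back
    to its partner. *)
Definition alt_step (S : {set Y}) (f : {ffun Y -> X}) : rel X :=
  fun x x' => [exists y in S, e x y && (f y == x')].

(** Serves both to enlarge a matching ([y] outside [S]) and to give a matched [y] a new partner,
    freeing the old one. *)
Lemma matching_update (S : {set Y}) (f : {ffun Y -> X}) (x : X) (y : Y) :
  matching S f -> x \notin f @: S -> e x y ->
  matching (y |: S) [ffun z => if z == y then x else f z].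
Proof.
move=> /matchingP[finj fe] xf exy; apply/matchingP; split.
- move=> z1 z2; rewrite !inE !ffunE.
  have [->|n1] := eqVneq z1 y; have [->|n2] := eqVneq z2 y => //=.
  + by move=> _ z2S xE; case/negP: xf; rewrite xE imset_f.
  + by move=> z1S _ xE; case/negP: xf; rewrite -xE imset_f.
  exact: finj.
- by move=> z; rewrite !inE ffunE; have [-> //|_ /=] := eqVneq z y; apply: fe.
Qed.

(** Otherwise switching edges along the path would enlarge the matching. Each switch changes [f] but
    not [S], so maximality survives the induction. *)
Lemma alternating_path_matched (S : {set Y}) (f : {ffun Y -> X}) x p y :
    (forall S' f', matching S' f' -> #|S'| <= #|S|) ->
    matching S f -> x \notin f @: S -> path (alt_step S f) x p ->
    uniq (x :: p) -> e (last x p) y ->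
  y \in S.
Proof.
move=> Smax; elim: p x f => [|x1 p IHp] x f fM xf.
  move=> _ _ /= exy; apply: contraT => yS.
  by have := Smax _ _ (matching_update _ _ _ _ fM xf exy); rewrite cardsU1 yS ltnn.
(* Rematching the first pair y1 of the path to x frees x1 = f y1, and keeps
   the rest of the path alternating since it does not return to x1. *)
move=> /= /andP[/exists_inP[y1 y1S /andP[exy1 /eqP fy1]] pP].
rewrite inE negb_or -andbA => /and4P[xx1 xp x1p pU].
set f' := [ffun z => if z == y1 then x else f z].
have f'M : matching S f'.
  by have := matching_update _ _ _ _ fM xf exy1; rewrite (setUidPr _) ?sub1set.
have [finj _] := matchingP _ _ fM.
apply: (IHp x1 f') => //=; last by rewrite x1p.
- apply/imsetP => -[z zS]; rewrite ffunE; case: eqVneq => [_ x1x|zy1].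
    by rewrite x1x eqxx in xx1.
  by rewrite -fy1 => /finj zE; rewrite zE ?eqxx in zy1.
- move: x1p pP; move: {2 3}x1 => z; elim: p z {IHp xp pU} => //= x2 p IHp z.
  rewrite inE negb_or => /andP[x12 x1p] /andP[/exists_inP[y2 y2S /andP[ey2 fy2]]].
  move/(IHp _ x1p) => ->; rewrite andbT; apply/exists_inP; exists y2 => //.
  rewrite ey2 ffunE; have [y21|//] := eqVneq y2 y1.
  by rewrite y21 fy1 (negPf x12) in fy2.
Qed.

(** König's argument: [N] and the complement of [A] together cover all edges of [e]. *)
Lemma matching_cover (x0 : X) :
  exists (A : {set X}) (S : {set Y}) (f : {ffun Y -> X}),
    let N := [set y | [exists x in A, e x y]] in
    [/\ matching S f, N \subset S & #|~: A| <= #|S :\: N|].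
Proof.
pose P (Sf : {set Y} * {ffun Y -> X}) := matching Sf.1 Sf.2.
have P0 : P (set0, [ffun=> x0]) by apply/matchingP; split=> y; rewrite inE.
have [[S f] /= fM Smax] := arg_maxnP (fun Sf => #|pred_of_set Sf.1|) P0.
pose A := [set x' | [exists x, (x \notin f @: S) && connect (alt_step S f) x x']].
have NS y x : x \in A -> e x y -> y \in S.
  rewrite inE => /existsP[z /andP[zf /connectP[p pP ->]]].
  case/shortenP: pP => p' p'P p'U _; apply: alternating_path_matched zf p'P p'U => //.
  by move=> S' f' /(Smax (S', f')).
exists A, S, f; split=> //.
  by apply/subsetP => y; rewrite inE => /exists_inP[x]; apply: NS.
(* [f] maps [S :\: N] onto the complement of [A]: an element outside [A] is matched, and were its
   partner adjacent to [A], one more step would reach it. *)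
apply: leq_trans (leq_imset_card f _); apply/subset_leq_card/subsetP => x.
rewrite inE => xA; have /imsetP[y yS xE] : x \in f @: S.
  by apply: contraR xA => xf; rewrite inE; apply/existsP; exists x; rewrite xf connect0.
rewrite xE imset_f // !inE yS andbT; apply: contra xA => /exists_inP[x'].
rewrite !inE => /existsP[z /andP[zf zx']] ex'y; apply/existsP; exists z.
rewrite zf (connect_trans zx') // connect1 //.
by apply/exists_inP; exists y; rewrite // ex'y xE eqxx.
Qed.

End Matching.

Arguments matchingP {X Y e S f}.

(** * Double counting and cliques *)

Lemma sum_degrees (U : finType) (k : nat) (E : {set {set U}}) :
  {in E, forall h : {set U}, #|h| = k} ->
  \sum_x #|[set h in E | x \in h]| = k * #|E|.
Proof.
move=> Ek; rewrite mulnC -sum_nat_const -(eq_bigr _ Ek).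
under eq_bigr => x _ do rewrite -sum1dep_card.
under [RHS]eq_bigr => h _ do rewrite -sum1_card.
rewrite (exchange_big_dep (mem E)) //= => [|x h _ /andP[] //].
by apply: eq_bigr => h hE; rewrite hE.
Qed.

Lemma sgraph_edgeP {U : finType} {G : sgraph U} {e : {set U}} :
  e \in edges G -> exists a b, a != b /\ e = [set a; b].
Proof.
by move=> eG; have /cards2P[a [b]] := forall_inP (edges_uniform G) _ eG; exists a, b.
Qed.

(** Cliques are recorded as vertex sets, so that hyperedges can be cliques. *)
Definition cliques {U : finType} (k : nat) (G : sgraph U) : {set {set U}} :=
  [set h : {set U} | (#|h| == k) &&
    [forall e : {set U}, (#|e| == 2) && (e \subset h) ==> (e \in edges G)]].

Lemma clique_copy {U : finType} {k : nat} {G : sgraph U} {h : {set U}} :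
  h \in cliques k G -> exists2 q, q \in copies (complete k) G & q.1 = h.
Proof.
rewrite inE => /andP[/eqP <- /forallP hG].
pose phi := [ffun i : 'I_#|h| => enum_val i].
have phi_inj : injective phi by move=> i j; rewrite !ffunE; apply: enum_val_inj.
have phi_h (e : {set 'I_#|h|}) : phi @: e \subset h.
  by apply/subsetP => y /imsetP[i _ ->]; rewrite ffunE enum_valP.
exists (phi @: [set: 'I_#|h|], [set phi @: (e : {set _}) | e in edges (complete #|h|)]).
  apply: imset_f; rewrite inE; apply/andP; split; first exact/injectiveP.
  apply/forall_inP => e; rewrite inE => e2; apply: (implyP (hG _)).
  by rewrite card_imset // e2 phi_h.
by apply/eqP; rewrite /= eqEcard phi_h card_imset // cardsT card_ord leqnn.
Qed.

(** * Neighbourhoods in [F]-free graphs *)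

Section Links.
Variable U : finType.
Implicit Types G : sgraph U.

Definition neighbours G (x : U) : {set U} := [set y | [set x; y] \in edges G].

Lemma neighbours_irrefl G x : x \notin neighbours G x.
Proof.
rewrite inE; apply/negP => /(forall_inP (edges_uniform G)).
by rewrite setUid cards1.
Qed.

Lemma card_neighbours G x : #|neighbours G x| = #|[set e in edges G | x \in e]|.
Proof.
have <- : [set [set x; y] | y in neighbours G x] = [set e in edges G | x \in e].
  apply/setP => e; rewrite inE; apply/imsetP/andP => [[y]|[eG]].
    by rewrite inE => yG ->; rewrite yG set21.
  have [a [b [_ eE]]] := sgraph_edgeP eG; move: eG; rewrite eE => eG.
  rewrite !inE => /orP[] /eqP xE; first by exists b; rewrite ?inE xE.
  by exists a; rewrite ?inE xE setUC.
rewrite card_in_imset // => y z yN zN /setP/(_ y).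
rewrite !inE eqxx orbT => /esym/orP[]/eqP // yx.
by case/negP: (neighbours_irrefl G x); rewrite -{1}yx.
Qed.

Fact induced_uniform G (A : {set U}) :
  uniform 2 [set e : {set 'I_#|A|} | enum_val @: e \in edges G].
Proof.
apply/forall_inP => e; rewrite inE => /(forall_inP (edges_uniform G)).
by rewrite card_imset //; apply: enum_val_inj.
Qed.

(** Relabelled by ordinals, to be a candidate in the maximum [ex_copies]. *)
Definition induced G (A : {set U}) : sgraph 'I_#|A| :=
  Hypergraph (induced_uniform G A).

Lemma contains_cone (T : finType) (F : sgraph T) (v : T) G (x : U) :
  contains (del_vertex F v) (induced G (neighbours G x)) -> contains F G.
Proof.
case/set0Pn => psi; rewrite inE => /andP[/injectiveP psi_inj /forall_inP psiF].
(* [insub t] fails only at [t = v], so the default [x] is the image of [v]; being adjacent to all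
   other images, it supplies the edges at [v]. *)
pose phi := [ffun t => oapp (fun s => enum_val (psi s)) x (insub t)].
have phi_val (s : {x | x != v}) : phi (val s) = enum_val (psi s) by rewrite ffunE valK.
have phi_v : phi v = x by rewrite ffunE insubF //= eqxx.
have phiN (s : {x | x != v}) : phi (val s) \in neighbours G x by rewrite phi_val enum_valP.
have phi_edge (s t : {x | x != v}) :
    [set val s; val t] \in edges F -> [set phi (val s); phi (val t)] \in edges G.
  have -> : [set val s; val t] = val @: [set s; t] by rewrite imsetU1 imset_set1.
  move=> stF; have := psiF [set s; t]; rewrite !inE => /(_ stF).
  by rewrite !(imsetU1, imset_set1) !phi_val.
have cases t : t = v \/ exists s : {x | x != v}, t = val s.
  by have [->|tv] := eqVneq t v; [left | right; exists (Sub t tv)].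
apply/set0Pn; exists phi; rewrite inE; apply/andP; split.
  apply/injectiveP => t1 t2; case: (cases t1) => [->|[s1 ->]].
    case: (cases t2) => [-> //|[s2 ->]]; rewrite phi_v => xE.
    by case/negP: (neighbours_irrefl G x); rewrite {1}xE phiN.
  case: (cases t2) => [->|[s2 ->]]; last by rewrite !phi_val => /enum_val_inj/psi_inj ->.
  by rewrite phi_v => xE; case/negP: (neighbours_irrefl G x); rewrite -{1}xE phiN.
apply/forall_inP => e eF; have [a [b [ab eE]]] := sgraph_edgeP eF.
move: eF; rewrite {e}eE imsetU1 imset_set1.
case: (cases a) ab => [->|[s ->]]; case: (cases b) => [->|[t ->]] ab.
- by rewrite eqxx in ab.
- by move=> _; have := phiN t; rewrite inE phi_v.
- by move=> _; have := phiN s; rewrite inE phi_v setUC.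
- exact: phi_edge.
Qed.

Lemma cliques_at_vertex (r : nat) G (x : U) : 0 < r ->
  #|[set h in cliques r G | x \in h]| <=
  #|copies (complete r.-1) (induced G (neighbours G x))|.
Proof.
move=> r_gt0.
set C := copies _ _.
(* [lift] undoes the removal of [x], which turns an [r]-clique through [x] into an [(r-1)]-clique of
   its neighbourhood. *)
pose lift (q : {set 'I_#|neighbours G x|} * {set {set 'I_#|neighbours G x|}}) :=
  x |: enum_val @: q.1.
apply: leq_trans (leq_imset_card lift C).
apply/subset_leq_card/subsetP => h; rewrite !inE => /andP[/andP[/eqP hr /forallP hG] xh].
have hN : h :\ x \subset neighbours G x.
  apply/subsetP => y; rewrite !inE => /andP[yx yh]; apply: (implyP (hG _)).
  by rewrite cards2 (eq_sym x) yx subUset !sub1set xh.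
pose K := [set i : 'I_#|neighbours G x| | enum_val i \in h :\ x].
have KE : enum_val @: K = h :\ x.
  apply/setP => y; apply/imsetP/idP => [[i]|yh]; first by rewrite inE => iK ->.
  have yN := subsetP hN _ yh.
  by exists (enum_rank_in yN y); rewrite ?[_ \in K]inE enum_rankK_in.
have Kc : K \in cliques r.-1 (induced G (neighbours G x)).
  rewrite inE -(card_imset _ enum_val_inj) KE -hr (cardsD1 x h) xh eqxx /=.
  apply/forallP => e; apply/implyP => /andP[e2 eK]; rewrite inE.
  apply: (implyP (hG _)); rewrite card_imset ?e2 /=; last exact: enum_val_inj.
  by apply: subset_trans (imsetS _ eK) _; rewrite KE subsetDl.
have [q qc qK] := clique_copy Kc.
by apply/imsetP; exists q; rewrite // /lift qK KE setD1K.
Qed.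

End Links.

(** * Red and blue edges, and the final count *)

Lemma berge_free_dichotomy (r : nat) (T U : finType) (F : sgraph T)
    (H : hypergraph r U) : ~~ contains_berge F H ->
  exists G R : sgraph U, [/\ ~~ contains F G, edges R \subset edges G &
    #|edges H| <= #|cliques r R| + #|edges G :\: edges R|].
Proof.
(* Both sides of the bipartite graph consist of all vertex sets; non-hyperedges on the left and
   non-pairs on the right are isolated. *)
pose e (h p : {set U}) := [&& h \in edges H, #|p| == 2 & p \subset h].
move=> HF; have [A [S [f]]] := matching_cover _ _ e set0.
set N := [set y | _] => -[/matchingP[finj fe] NS cardA].
have S2 p : p \in S -> #|p| == 2 by move=> /fe/and3P[].
have Su : uniform 2 S by apply/forall_inP.
have Nu : uniform 2 N by apply/forall_inP => p /(subsetP NS)/S2.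
exists (Hypergraph Su), (Hypergraph Nu); split=> //=.
  (* The partners under [f] of the edges of a copy of [F] are distinct hyperedges, forming a Berge
     copy. *)
  apply: contra HF => /set0Pn[phi]; rewrite inE => /andP[phi_inj /forall_inP phiF].
  apply/existsP; exists phi; apply/existsP; exists [ffun d : {set T} => f (phi @: d)].
  rewrite phi_inj /=; apply/andP; split.
    apply/dinjectiveP => d d' dF d'F; rewrite !ffunE => /finj.
    move=> /(_ (phiF _ dF) (phiF _ d'F)); exact/imset_inj/injectiveP.
  by apply/forall_inP => d /phiF/fe; rewrite ffunE => /and3P[-> _ ->].
have sub : edges H \subset cliques r (Hypergraph Nu) :|: ~: A.
  apply/subsetP => h hH; rewrite !inE; case: (boolP (h \in A)) => hA; last by rewrite orbT.
  rewrite (forall_inP (edges_uniform H)) //=; apply/orP; left.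
  apply/forallP => p; apply/implyP => /andP[p2 ph]; rewrite inE.
  by apply/exists_inP; exists h; rewrite // /e hH p2.
apply: leq_trans (subset_leq_card sub) _; apply: leq_trans (leq_card_setU _ _) _.
by rewrite leq_add2l.
Qed.

(** Neighbourhoods have varying sizes [m <= n], hence one [c] for all such [m]; the degrees then sum
    to twice the number of edges. *)
Lemma clique_count_le (R : realFieldType) (T : finType) (F : sgraph T) (v : T)
    (r : nat) (c : R) (n : nat) (G : sgraph 'I_n) :
    (0 < r)%N -> ~~ contains F G ->
    (forall m : nat, (m <= n)%N ->
      ((ex_copies m (complete r.-1) (del_vertex F v))%:R <= c * m%:R)%R) ->
  (r%:R * #|cliques r G|%:R <= c * (2 * #|edges G|%:R))%R.
Proof.
move=> r_gt0 GF exc.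
have cliq : {in cliques r G, forall h : {set 'I_n}, #|h| = r}.
  by move=> h; rewrite inE => /andP[/eqP].
have edg : {in edges G, forall h : {set 'I_n}, #|h| = 2}.
  by move=> h hG; apply/eqP/(forall_inP (edges_uniform G)).
rewrite -!natrM -(sum_degrees _ _ _ cliq) -(sum_degrees _ _ _ edg) !natr_sum.
rewrite mulr_sumr; apply: ler_sum => x _; rewrite -card_neighbours.
have degn : (#|neighbours _ G x| <= n)%N by rewrite -[leqRHS]card_ord max_card.
apply: le_trans (exc _ degn); rewrite ler_nat.
apply: leq_trans (cliques_at_vertex _ _ _ _ _) _ => //.
by apply: (leq_bigmax_cond (induced _ G (neighbours _ G x))); apply: contra GF; apply: contains_cone.
Qed.

Local Open Scope ring_scope.

Theorem lemma4 (R : realFieldType) (T : finType) (F : sgraph T) (v : T)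
  (r : nat) (hr : (0 < r)%N) (c : nat -> R)
  (hc : forall n m : nat, (m <= n)%N ->
     (ex_copies m (complete r.-1) (del_vertex F v))%:R <= c n * m%:R)
  (n : nat) :
  (ex_berge r n F)%:R <= Num.max (2 * c n / r%:R) 1 * (ex n F)%:R.
Proof.
set M := Num.max _ _; have M1 : 1 <= M by rewrite le_max lexx orbT.
have M0 : 0 <= M := le_trans ler01 M1.
have bound (H : hypergraph r 'I_n) : ~~ contains_berge F H ->
    #|edges H|%:R <= M * (ex n F)%:R.
  case/berge_free_dichotomy => G [Rd [GF RG cardH]].
  have RF : ~~ contains F Rd.
    apply: contra GF => /set0Pn[phi]; rewrite inE => /andP[phi_inj /forall_inP phiR].
    apply/set0Pn; exists phi; rewrite inE phi_inj /=.
    by apply/forall_inP => d /phiR; apply: (subsetP RG).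
  have cliqR : #|cliques r Rd|%:R <= M * #|edges Rd|%:R.
    have r0 : 0 < r%:R :> R by rewrite ltr0n.
    apply: (@le_trans _ _ (2 * c n / r%:R * #|edges Rd|%:R)).
      rewrite mulrAC ler_pdivlMr // mulrC -mulrA mulrCA.
      exact: clique_count_le hr RF (hc n).
    by rewrite ler_wpM2r ?ler0n // le_max lexx.
  (* Red edges pay for the cliques by [cliqR], and blue edges for themselves since [1 <= M]. *)
  apply: (@le_trans _ _ (M * #|edges G|%:R)); last first.
    by rewrite ler_wpM2l // ler_nat; apply: (leq_bigmax_cond G).
  rewrite -(cardsID (edges Rd) (edges G)) (setIidPr RG) natrD mulrDr.
  apply: le_trans (_ : (#|cliques r Rd| + #|edges G :\: edges Rd|)%:R <= _).
    by rewrite ler_nat.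
  by rewrite natrD lerD // ler_peMl.
(* The first case is the value 0 of an empty maximum. *)
rewrite /ex_berge; elim/big_ind: _ => [|m1 m2 m1M m2M|H /bound //].
  by rewrite mulr_ge0.
by rewrite /maxn; case: ifP.
Qed.
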